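(* Let $n \ge 7$ and $d$ be integers with $2 \le d \le \exp\left(\frac{n}{3}\right)$. Let $Z^{(n)}_1, Z^{(n)}_2, \dots, Z^{(n)}_d$ be $d$ independent symmetric random walks of length $n$. Then $$ \mathbf{E}\left[\max_{1 \le i \le d} Z^{(n)}_i\right] \ge \frac{1 - \exp\left(-\frac{\sqrt{\ln d}}{3.1\sqrt{2\pi}}\right)}{\sqrt{\psi\left(\frac{1.6\sqrt{\ln d}}{2\sqrt{n}}\right)}}\,\sqrt{n}\left(\sqrt{2\ln d - 2\ln\ln d} - 1\right) - \sqrt{n}, $$ and moreover the right-hand side satisfies $$ \frac{1 - \exp\left(-\frac{\sqrt{\ln d}}{3.1\sqrt{2\pi}}\right)}{\sqrt{\psi\left(\frac{1.6\sqrt{\ln d}}{2\sqrt{n}}\right)}}\,\sqrt{n}\left(\sqrt{2\ln d - 2\ln\ln d} - 1\right) - \sqrt{n} \ \ge\ 0.09\sqrt{n\ln d} - 2\sqrt{n}. $$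
   Context: A symmetric random walk of length $n$ is a random variable $Z^{(n)} = Y_1 + Y_2 + \dots + Y_n$ where $Y_1,\dots,Y_n$ are i.i.d. Rademacher variables, i.e. $\Pr[Y_i = +1] = \Pr[Y_i = -1] = 1/2$. For $p \in [0,1]$ and $q \in (0,1)$, $D(p\|q) = p\ln\left(\frac{p}{q}\right) + (1-p)\ln\left(\frac{1-p}{1-q}\right)$ (with $0\ln 0 = 0$) is the Kullback-Leibler divergence between the Bernoulli distributions with parameters $p$ and $q$. The function $\psi : [-\frac12,\frac12] \to \mathbb{R}$ is defined by $$\psi(x) = \frac{D\left(\frac12 + x \,\middle\|\, \frac12\right)}{2x^2} \quad (x \ne 0), \qquad \psi(0) = 1.$$ $\ln$ is the natural logarithm. *)

(* Defs.v *)
From HB Require Import structures.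
From mathcomp Require Import all_boot all_order all_algebra.
From mathcomp Require Import all_classical all_reals all_analysis.

Set Implicit Arguments.
Unset Strict Implicit.
Unset Printing Implicit Defensive.

Import Order.TTheory GRing.Theory Num.Theory.
Import numFieldNormedType.Exports.

Local Open Scope classical_set_scope.
Local Open Scope ring_scope.

(* The product rule is required for every subfamily J and all Borel sets B i. *)
Definition mutually_independent (disp : measure_display)
    (T : measurableType disp) (R : realType) (P : probability T R)
    (I : finType) (X : I -> {RV P >-> R}) : Prop :=
  forall (J : {set I}) (B : I -> set R),
    (forall i, i \in J -> measurable (B i)) ->
    P (\bigcap_(i in [set` J]) (X i @^-1` B i)) =
    (\prod_(i in J) P (X i @^-1` B i))%E.

Definition rademacher (disp : measure_display) (T : measurableType disp)
    (R : realType) (P : probability T R) (Y : {RV P >-> R}) : Prop :=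
  P (Y @^-1` [set 1]) = (1 / 2)%:E /\ P (Y @^-1` [set -1]) = (1 / 2)%:E.

Definition symmetric_random_walk (disp : measure_display)
    (T : measurableType disp) (R : realType) (P : probability T R) (n : nat)
    (Z : {RV P >-> R}) : Prop :=
  exists Y : 'I_n -> {RV P >-> R},
    [/\ mutually_independent Y,
        forall j, rademacher (Y j) &
        forall t, Z t = \sum_(j < n) Y j t].

(* For p in [0, 1] and q in (0, 1); the convention 0 ln 0 = 0 is automatic. *)
Definition KL_bernoulli (R : realType) (p q : R) : R :=
  p * ln (p / q) + (1 - p) * ln ((1 - p) / (1 - q)).

(* Only meaningful for x in [-1/2, 1/2]. *)
Definition psi (R : realType) (x : R) : R :=
  if x == 0 then 1 else KL_bernoulli (1 / 2 + x) (1 / 2) / (2 * x ^+ 2).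

(* Main.v *)
(* Write L = ln d, Q = sqrt (2 L - 2 ln L), r = sqrt (psi x0) with x0 the
   argument of psi in the theorem, and t = sqrt n (Q - 1) / r.

   Large d (L >= 4).  Since max_i Z_i >= t on the event {max_i Z_i >= t} and
   max_i Z_i >= - |Z_0| >= - (Z_0^2 / sqrt n + sqrt n) / 2 everywhere, we get
   E max >= t P(max >= t) - sqrt n, and independence gives
   P(max >= t) >= 1 - exp (- d p) for any p <= P(Z_i >= t).  Stirling's bounds
   give 'C(n, k) / 2^n >= exp (- n D(k/n || 1/2)) / (2 sqrt n).  Every integer k
   with t <= 2 k - n <= sqrt n Q / r satisfies n D(k/n || 1/2) <= Q^2 / 2
   because psi is nondecreasing, and there are at least sqrt n / (4 r) such k;
   the term -1 of the theorem is the width of that window.  Hence one may take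
   p = exp (- Q^2 / 2) / (8 r) = L / (8 r d), so that d p exceeds the exponent
   required by the theorem.

   Small d (L <= 4).  The bound is nonpositive, while E max >= E Z_0 = 0. *)

Require Import Defs.
From HB Require Import structures.
From mathcomp Require Import all_boot all_order all_algebra.
From mathcomp Require Import all_classical all_reals all_analysis.
From mathcomp Require Import measurable_realfun ring lra.

Import Order.TTheory GRing.Theory Num.Theory.
Import numFieldNormedType.Exports.

Local Open Scope classical_set_scope.
Local Open Scope ring_scope.

Set Implicit Arguments.
Unset Strict Implicit.
Unset Printing Implicit Defensive.

(** * The function psi *)

(** Tool for comparing functions below: the difference of the two sides is differentiated, and the
    explicit [f'] leaves its sign to be checked in factored form. *)
Lemma is_derive_ge0_le (R : realType) (f f' : R -> R) (a b : R) : a <= b ->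
  (forall x, a <= x <= b -> is_derive x (1 : R) f (f' x)) ->
  (forall x, a < x < b -> 0 <= f' x) -> f a <= f b.
Proof.
move=> ab df f'ge0.
have dfx x : x \in `]a, b[ -> is_derive x (1 : R) f (f' x).
  by rewrite in_itv /= => /andP[ax xb]; apply: df; rewrite !ltW.
apply: (@ger0_derive1_ndecr R f a b) => //.
- by move=> x /dfx /@ex_derive.
- move=> x xab; rewrite derive1E; have [_ ->] := dfx _ xab.
  by apply: f'ge0; rewrite in_itv /= in xab.
- apply: derivable_within_continuous => x; rewrite in_itv /= => xab.
  by have /@ex_derive := df _ xab.
Qed.

(** The differentiation rules are restated with explicit abstractions, so that [derive_rules] can
    match them on unfolded expressions. *)
Lemma is_derive_add (R : realType) (f g : R -> R) (x a b : R) :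
  is_derive x (1 : R) f a -> is_derive x (1 : R) g b ->
  is_derive x (1 : R) (fun t => f t + g t) (a + b).
Proof. exact: is_deriveD. Qed.

Lemma is_derive_opp (R : realType) (f : R -> R) (x a : R) :
  is_derive x (1 : R) f a -> is_derive x (1 : R) (fun t => - f t) (- a).
Proof. exact: is_deriveN. Qed.

Lemma is_derive_mul (R : realType) (f g : R -> R) (x a b : R) :
  is_derive x (1 : R) f a -> is_derive x (1 : R) g b ->
  is_derive x (1 : R) (fun t => f t * g t) (f x * b + g x * a).
Proof. exact: is_deriveM. Qed.

Lemma is_derive_inv (R : realType) (f : R -> R) (x a : R) : f x != 0 ->
  is_derive x (1 : R) f a ->
  is_derive x (1 : R) (fun t => (f t)^-1) (- a / f x ^+ 2).
Proof.
move=> fx0 df; have := is_deriveV fx0 df.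
by rewrite /GRing.scale /= mulNr mulrC -mulNr.
Qed.

Lemma is_derive_ln_comp (R : realType) (f : R -> R) (x a : R) : 0 < f x ->
  is_derive x (1 : R) f a ->
  is_derive x (1 : R) (fun t => ln (f t)) (a / f x).
Proof.
move=> fx0 df; rewrite mulrC; apply: (@is_derive1_comp _ (@ln R) f) => //.
exact: is_derive1_ln.
Qed.

Ltac derive_rules :=
  do ?[exact: is_derive_cst | exact: is_derive_id
      | apply: is_derive_add | apply: is_derive_opp | apply: is_derive_mul
      | apply: is_derive_inv | apply: is_derive_ln_comp].

(** The Pade approximant of order (1, 1) of [ln] at 1; with [z = e^u] this is
    [tanh (u / 2) <= u / 2]. The gap has derivative [(x - 1)^2 / (x (x + 1)^2)]. *)
Lemma ln_ge_pade (R : realType) (z : R) :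
  1 <= z -> 2 * (z - 1) / (z + 1) <= ln z.
Proof.
move=> z1.
pose f (x : R) : R := ln x - 2 + 4 * (x + 1)^-1.
suff : f 1 <= f z.
  rewrite /f ln1 (_ : (1 + 1)^-1 = 1 / 2 :> R); last by field.
  move=> h; suff -> : 2 * (z - 1) / (z + 1) = 2 - 4 / (z + 1) by lra.
  by field; rewrite gt_eqF//; lra.
apply: (@is_derive_ge0_le _ f (fun x => x^-1 - 4 / (x + 1) ^+ 2)) => // x.
- move=> /andP[x1 _].
  have x0 : 0 < x by lra.
  have x1' : x + 1 != 0 by rewrite gt_eqF//; lra.
  apply: is_derive_eq; first by rewrite /f; derive_rules.
  by rewrite /GRing.scale /=; field; rewrite ?gt_eqF//; lra.
- move=> /andP[x1 _].
  suff -> : x^-1 - 4 / (x + 1) ^+ 2 = (x - 1) ^+ 2 / (x * (x + 1) ^+ 2).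
    by rewrite divr_ge0 ?sqr_ge0// mulr_ge0 ?sqr_ge0//; lra.
  by field; rewrite !gt_eqF//; lra.
Qed.

(** With [z = e^u] this is [u <= sinh u]. *)
Lemma ln_le_half_subV (R : realType) (z : R) : 1 <= z -> ln z <= (z - z^-1) / 2.
Proof.
move=> z1.
pose f (x : R) : R := (x - x^-1) / 2 - ln x.
suff : f 1 <= f z by rewrite /f ln1 invr1; lra.
apply: (@is_derive_ge0_le _ f (fun x => (x - 1) ^+ 2 / (2 * x ^+ 2))) => // x.
- move=> /andP[x1 _].
  have x0 : 0 < x by lra.
  have x1' : x != 0 by rewrite gt_eqF.
  apply: is_derive_eq; first by rewrite /f; derive_rules.
  by rewrite /GRing.scale /=; field; rewrite ?gt_eqF//; lra.
- by move=> _; rewrite divr_ge0 ?sqr_ge0// mulr_ge0 ?sqr_ge0.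
Qed.

(** Twice the divergence of [(1 + y) / 2] from [1 / 2]; the variable [y = 2 x] makes [psi x] equal
    to [phi y / y^2]. *)
Definition phi (R : realType) (y : R) : R :=
  (1 + y) * ln (1 + y) + (1 - y) * ln (1 - y).

Lemma is_derive_phi (R : realType) (y : R) : 0 <= y < 1 ->
  is_derive y (1 : R) (@phi R) (ln (1 + y) - ln (1 - y)).
Proof.
move=> /andP[y0 y1].
have yp : 0 < 1 + y by lra.
have ym : 0 < 1 - y by lra.
apply: is_derive_eq; first by rewrite /phi; derive_rules.
by rewrite /GRing.scale /=; field; rewrite !gt_eqF//; lra.
Qed.

Lemma phi0 (R : realType) : phi (0 : R) = 0.
Proof. by rewrite /phi addr0 subr0 ln1 !mulr0 addr0. Qed.

(** At [z = (1 + y) / (1 - y)] the Pade bound is exactly [2 y]; at the same point [ln_le_half_subV]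
    yields [ln_ratio_le]. *)
Lemma ln_ratio_ge (R : realType) (y : R) : 0 <= y < 1 ->
  2 * y <= ln (1 + y) - ln (1 - y).
Proof.
move=> /andP[y0 y1].
have ym : 0 < 1 - y by lra.
have z1 : 1 <= (1 + y) / (1 - y) by rewrite ler_pdivlMr//; lra.
have := ln_ge_pade z1; rewrite ln_div ?posrE//; last by lra.
congr (_ <= _); field; rewrite !gt_eqF//=; lra.
Qed.

Lemma ln_ratio_le (R : realType) (y : R) : 0 <= y < 1 ->
  ln (1 + y) - ln (1 - y) <= 2 * y / (1 - y ^+ 2).
Proof.
move=> /andP[y0 y1].
have yp : 0 < 1 + y by lra.
have ym : 0 < 1 - y by lra.
have y2 : 0 < 1 - y ^+ 2 by nra.
have z1 : 1 <= (1 + y) / (1 - y) by rewrite ler_pdivlMr//; lra.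
have := ln_le_half_subV z1; rewrite ln_div ?posrE//.
congr (_ <= _); field; rewrite !gt_eqF//=; lra.
Qed.

Lemma phi_ge_sqr (R : realType) (y : R) : 0 <= y < 1 -> y ^+ 2 <= phi y.
Proof.
move=> /andP[y0 y1].
pose f (x : R) : R := phi x - x * x.
suff : f 0 <= f y by rewrite /f phi0 expr2; lra.
apply: (@is_derive_ge0_le _ f (fun x => ln (1 + x) - ln (1 - x) - 2 * x)) => //.
- move=> x xy; apply: is_derive_eq.
    by rewrite /f; apply: is_derive_add; apply: is_derive_phi; lra.
  by rewrite /GRing.scale /=; ring.
- by move=> x xy; rewrite subr_ge0; apply: ln_ratio_ge; lra.
Qed.

(** Apply [ln (1 + u) <= u] at [u = y] and [u = - y]: [(1 + y) y - (1 - y) y = 2 y^2]. *)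
Lemma phi_le_sqr (R : realType) (y : R) : 0 <= y < 1 -> phi y <= 2 * y ^+ 2.
Proof.
move=> /andP[y0 y1].
have h1 : ln (1 + y) <= y by apply: le_ln1Dx; lra.
have h2 : ln (1 - y) <= - y by apply: le_ln1Dx; lra.
have : (1 + y) * ln (1 + y) <= (1 + y) * y by apply: ler_wpM2l => //; lra.
have : (1 - y) * ln (1 - y) <= (1 - y) * - y by apply: ler_wpM2l => //; lra.
by rewrite /phi; lra.
Qed.

(** Gives the sign of the derivative of [phi y / y^2]. The gap [y phi' - 2 phi] vanishes at 0 and
    has derivative [y phi'' - phi'] with [phi'' = 2 / (1 - y^2)], nonnegative by [ln_ratio_le]. *)
Lemma double_phi_le (R : realType) (y : R) : 0 <= y < 1 ->
  2 * phi y <= y * (ln (1 + y) - ln (1 - y)).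
Proof.
move=> /andP[y0 y1].
pose f (x : R) : R := x * (ln (1 + x) - ln (1 - x)) - 2 * phi x.
suff : f 0 <= f y by rewrite /f phi0; lra.
apply: (@is_derive_ge0_le _ f
  (fun x => 2 * x / (1 - x ^+ 2) - (ln (1 + x) - ln (1 - x)))) => //.
- move=> x xy.
  have xp : 0 < 1 + x by lra.
  have xm : 0 < 1 - x by lra.
  have x2 : 0 < 1 - x ^+ 2 by nra.
  apply: is_derive_eq.
    rewrite /f; apply: is_derive_add; first by derive_rules.
    by apply: is_derive_opp; apply: is_derive_mul; apply: is_derive_phi; lra.
  by rewrite /GRing.scale /=; field; rewrite !gt_eqF.
- by move=> x xy; rewrite subr_ge0; apply: ln_ratio_le; lra.
Qed.

Lemma phi_ratio_ndecr (R : realType) (y z : R) : 0 < y -> y <= z -> z < 1 ->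
  phi y / y ^+ 2 <= phi z / z ^+ 2.
Proof.
move=> y0 yz z1.
pose f (x : R) : R := phi x * (x * x)^-1.
suff : f y <= f z by rewrite /f !expr2.
apply: (@is_derive_ge0_le _ f
  (fun x => (x * (ln (1 + x) - ln (1 - x)) - 2 * phi x) / x ^+ 3)) => //.
- move=> x xy.
  have x0 : 0 < x by lra.
  have xx0 : x * x != 0 by rewrite gt_eqF// mulr_gt0.
  apply: is_derive_eq.
    by rewrite /f; apply: is_derive_mul; apply: is_derive_phi; lra.
  by rewrite /GRing.scale /=; field; rewrite !gt_eqF.
- move=> x xy; apply: divr_ge0; last by rewrite exprn_ge0; lra.
  by rewrite subr_ge0; apply: double_phi_le; lra.
Qed.

Lemma KL_bernoulli_half (R : realType) (x : R) : - (1 / 2) < x < 1 / 2 ->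
  KL_bernoulli (1 / 2 + x) (1 / 2) = phi (2 * x) / 2.
Proof.
move=> /andP[x0 x1]; rewrite /KL_bernoulli /phi.
rewrite (_ : (1 / 2 + x) / (1 / 2) = 1 + 2 * x); last by field.
rewrite (_ : (1 - (1 / 2 + x)) / (1 - 1 / 2) = 1 - 2 * x); last by field.
by field.
Qed.

Lemma psiE (R : realType) (x : R) : 0 < x < 1 / 2 ->
  psi x = phi (2 * x) / (2 * x) ^+ 2.
Proof.
move=> /andP[x0 x1]; rewrite /psi gt_eqF// KL_bernoulli_half; last by lra.
by field; rewrite gt_eqF.
Qed.

Lemma psi_ge1 (R : realType) (x : R) : 0 < x < 1 / 2 -> 1 <= psi x.
Proof.
move=> x01; rewrite psiE// ler_pdivlMr ?mul1r; last by rewrite exprn_gt0; lra.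
by apply: phi_ge_sqr; lra.
Qed.

Lemma psi_le2 (R : realType) (x : R) : 0 < x < 1 / 2 -> psi x <= 2.
Proof.
move=> x01; rewrite psiE// ler_pdivrMr; last by rewrite exprn_gt0; lra.
by apply: phi_le_sqr; lra.
Qed.

Lemma psi_ndecr (R : realType) (x y : R) : 0 < x -> x <= y -> y < 1 / 2 ->
  psi x <= psi y.
Proof.
move=> x0 xy y1; rewrite !psiE; [|lra..].
by apply: phi_ratio_ndecr; lra.
Qed.

(** * Stirling bounds and binomial probabilities *)

Lemma ln2_ge (R : realType) : 2 / 3 <= ln (2 : R).
Proof.
have := @ln_ge_pade R 2 (ltac:(lra)).
by congr (_ <= _); field.
Qed.

Lemma ln_sqrt (R : realType) (x : R) : 0 < x -> ln (Num.sqrt x) = ln x / 2.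
Proof.
move=> x0; rewrite -[in RHS](sqr_sqrtr (ltW x0)) lnXn ?sqrtr_gt0//.
by rewrite mulr2n; field.
Qed.

(** The middle term is the decrease of [ln x! - stirling x] from [x] to [x + 1]. Both bounds on [ln]
    at [z = (x + 1) / x] become explicit after multiplication by [x + 1 / 2]. *)
Lemma stirling_step (R : realType) (x : R) : 0 < x ->
  0 <= (x + 1 / 2) * (ln (x + 1) - ln x) - 1 <= (x^-1 - (x + 1)^-1) / 4.
Proof.
move=> x0.
have x1 : 0 < x + 1 by lra.
have z1 : 1 <= (x + 1) / x by rewrite ler_pdivlMr//; lra.
rewrite -ln_div ?posrE//.
have h1 := ln_ge_pade z1.
have h2 := ln_le_half_subV z1.
have p : 0 <= x + 1 / 2 by lra.
have {h1} := ler_wpM2l p h1.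
have {h2} := ler_wpM2l p h2.
rewrite [X in _ <= X -> _](_ : _ = 1 + (x^-1 - (x + 1)^-1) / 4); last first.
  by field; rewrite !gt_eqF.
rewrite [X in _ -> X <= _ -> _](_ : _ = 1); last first.
  by field; rewrite !gt_eqF//; lra.
lra.
Qed.

(** Logarithm of [sqrt x (x / e)^x]; the missing constant [ln (sqrt (2 pi))] lies between the 3/4
    and 1 used next. *)
Definition stirling (R : realType) (x : R) : R := (x + 1 / 2) * ln x - x.

(* The term [n^-1 / 4] makes the lower bound telescope along stirling_step. *)
Lemma ln_fact_stirling (R : realType) (n : nat) : (0 < n)%N ->
  stirling n%:R + 3 / 4 + n%:R^-1 / 4 <= ln (n`!%:R : R) <= stirling n%:R + 1.
Proof.
case: n => // n _; elim: n => [|n IHn].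
  by rewrite /stirling factS muln1 ln1 invr1; lra.
rewrite factS natrM lnM ?posrE ?ltr0n ?fact_gt0// -[in n.+2%:R]natr1.
set x : R := n.+1%:R in IHn *.
have x0 : 0 < x by rewrite ltr0n.
have := stirling_step x0; move: IHn; rewrite /stirling.
move: (ln x) (ln (x + 1)) (ln _) x^-1 (x + 1)^-1 => l0 l1 F v0 v1.
by move=> /andP[? ?] /andP[? ?]; apply/andP; split; lra.
Qed.

(** In the Stirling estimate of the three factorials, the main terms add up to the divergence; the
    square roots leave [sqrt (n / (k (n - k)))], at least [2 / sqrt n]. *)
Lemma bin_entropy_ge (R : realType) (n k : nat) : (0 < k < n)%N ->
  expR (- (n%:R * KL_bernoulli (k%:R / n%:R) (1 / 2))) / (2 * Num.sqrt n%:R)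
  <= 'C(n, k)%:R / 2 ^+ n :> R.
Proof.
move=> /andP[k0 kn].
have n0 : (0 < n)%N by apply: leq_trans kn.
have m0 : (0 < n - k)%N by rewrite subn_gt0.
have N0 : 0 < n%:R :> R by rewrite ltr0n.
have a0 : 0 < k%:R :> R by rewrite ltr0n.
have b0 : 0 < (n - k)%:R :> R by rewrite ltr0n.
have C0 : 0 < 'C(n, k)%:R :> R.
  by rewrite ltr0n bin_gt0; apply: ltnW.
have abN : k%:R + (n - k)%:R = n%:R :> R by rewrite -natrD subnKC// ltnW.
have s0 : 0 < Num.sqrt (n%:R : R) by rewrite sqrtr_gt0.
have lnC : ln ('C(n, k)%:R : R) = ln n`!%:R - ln k`!%:R - ln (n - k)`!%:R.
  rewrite -(bin_fact (ltnW kn)) !natrM !lnM ?posrE ?mulr_gt0 ?ltr0n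
    ?fact_gt0 ?bin_gt0 1?ltnW//.
  by ring.
have p2 : 0 < 2 ^+ n :> R by rewrite exprn_gt0.
have p3 : 0 < 2 * Num.sqrt n%:R :> R by rewrite mulr_gt0.
set E := expR _; have E0 : 0 < E by exact: expR_gt0.
suff : ln (E / (2 * Num.sqrt n%:R)) <= ln ('C(n, k)%:R / 2 ^+ n).
  by rewrite ler_ln// posrE divr_gt0.
rewrite !ln_div ?posrE// expRK lnM ?posrE// ln_sqrt// lnXn// lnC.
rewrite -[ln 2 *+ n]mulr_natl.
have -> : n%:R * KL_bernoulli (k%:R / n%:R) (1 / 2) =
   k%:R * ln k%:R + (n - k)%:R * ln (n - k)%:R
   - n%:R * ln n%:R + n%:R * ln 2 :> R.
  rewrite /KL_bernoulli.
  rewrite (_ : (1 - k%:R / n%:R) / (1 - 1 / 2) =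
      (n - k)%:R / n%:R * 2); last first.
    by rewrite -abN; field; rewrite gt_eqF// abN.
  rewrite (_ : k%:R / n%:R / (1 / 2) = k%:R / n%:R * 2); last first.
    by field; rewrite gt_eqF.
  rewrite !lnM ?posrE ?divr_gt0 ?invr_gt0// !lnV ?posrE//.
  have -> : 1 - k%:R / n%:R = (n - k)%:R / n%:R :> R.
    by rewrite -abN; field; rewrite gt_eqF// abN.
  move: (ln k%:R) (ln (n - k)%:R) (ln n%:R) (ln 2) => la lb lN l2.
  by rewrite -abN; field; rewrite gt_eqF// abN.
(* AM-GM: [4 k (n - k) <= n^2] *)
have amgm : 2 * ln 2 + ln k%:R + ln (n - k)%:R <= 2 * ln (n%:R : R).
  have -> : 2 * ln (n%:R : R) = ln (n%:R ^+ 2) by rewrite lnXn// mulr_natl.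
  have -> : 2 * ln (2 : R) = ln (2 ^+ 2) by rewrite lnXn// mulr_natl.
  rewrite -!lnM ?posrE ?mulr_gt0 ?exprn_gt0//.
  rewrite ler_ln ?posrE ?mulr_gt0 ?exprn_gt0//.
  rewrite -abN; have := sqr_ge0 (k%:R - (n - k)%:R : R); lra.
(* The additive constants leave [3/4 - 2 + 2 ln 2 >= 0] to be checked, for which [ln 2 >= 2/3]
   suffices. *)
have := ln2_ge R.
have /andP[+ _] := ln_fact_stirling R n0.
have /andP[_ +] := ln_fact_stirling R k0.
have /andP[_ +] := ln_fact_stirling R m0.
have : 0 <= n%:R^-1 :> R by rewrite invr_ge0 ltW.
move: amgm; rewrite /stirling -abN.
move: (ln n`!%:R) (ln k`!%:R) (ln (n - k)`!%:R) => fn fk fm.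
move: (k%:R + _)^-1 => z.
lra.
Qed.

(** * The law of a random walk *)

Lemma sum_sets_card (R : realType) (n : nat) (g : nat -> R) :
  \sum_(A : {set 'I_n}) g #|A| = \sum_(k < n.+1) 'C(n, k)%:R * g k.
Proof.
have cb (A : {set 'I_n}) : (#|A| < n.+1)%N.
  by rewrite ltnS -[X in (_ <= X)%N]card_ord max_card.
rewrite (partition_big (fun A : {set 'I_n} => Ordinal (cb A)) xpredT)//=.
apply: eq_bigr => k _.
rewrite (eq_bigr (fun=> g k)); last by move=> A /eqP <-.
rewrite sumr_const mulr_natl; congr (_ *+ _).
have <- : #|[set A : {set 'I_n} | #|A| == k]%SET| = 'C(n, k).
  by rewrite card_draws card_ord.
by apply: eq_card => A; rewrite !inE.
Qed.

Lemma sum_bin_rec (R : realType) (n : nat) (g : nat -> R) :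
  \sum_(k < n.+2) 'C(n.+1, k)%:R * g k =
  \sum_(k < n.+1) 'C(n, k)%:R * (g k + g k.+1).
Proof.
rewrite big_ord_recl/= bin0 mul1r.
under eq_bigr => i _ do rewrite /bump /= add1n binS natrD mulrDl.
rewrite big_split/=.
under [in RHS]eq_bigr => i _ do rewrite mulrDr.
rewrite [in RHS]big_split/= addrA; congr (_ + _).
rewrite big_ord_recr/= bin_small// mul0r addr0.
rewrite [in RHS]big_ord_recl/= bin0 mul1r.
by [].
Qed.

(** Mass 1, mean 0 and variance [n] of the walk in a single induction: averaging a quadratic in the
    position over one more step gives a quadratic again, with [c0] increased by [c2]. *)
Lemma sum_bin_moments (R : realType) (n : nat) (c0 c1 c2 : R) :
  \sum_(k < n.+1) 'C(n, k)%:R *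
    (c0 + c1 * (2 * k%:R - n%:R) + c2 * (2 * k%:R - n%:R) ^+ 2) =
  2 ^+ n * (c0 + c2 * n%:R).
Proof.
elim: n c0 c1 c2 => [|n IHn] c0 c1 c2.
  rewrite big_ord1 bin0 expr0 /=; ring.
rewrite (sum_bin_rec n (fun k => c0 + c1 * (2 * k%:R - n.+1%:R)
  + c2 * (2 * k%:R - n.+1%:R) ^+ 2)).
rewrite (eq_bigr (fun k : 'I_n.+1 => 'C(n, k)%:R *
    ((2 * c0 + 2 * c2) + 2 * c1 * (2 * k%:R - n%:R)
     + 2 * c2 * (2 * k%:R - n%:R) ^+ 2))); last first.
  by move=> k _; congr (_ * _); rewrite -!natr1; ring.
by rewrite IHn -natr1 exprS; ring.
Qed.

Section walk_law.
Variables (R : realType) (disp : measure_display) (T : measurableType disp).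
Variables (P : probability T R) (n : nat) (Y : 'I_n -> {RV P >-> R}).
Hypothesis indY : mutually_independent Y.
Hypothesis radY : forall j, rademacher (Y j).

Let sgn (A : {set 'I_n}) (j : 'I_n) : set R :=
  if j \in A then [set 1] else [set -1].

(** A sign pattern is encoded by its set [A] of up-steps, so that the endpoint depends on [#|A|]
    alone. *)
Let atom (A : {set 'I_n}) : set T :=
  \bigcap_(j in [set` [set: 'I_n]%SET]) (Y j @^-1` sgn A j).

Let msgn A j : measurable (sgn A j).
Proof. by rewrite /sgn; case: ifP. Qed.

Let matom A : measurable (atom A).
Proof.
apply: fin_bigcap_measurable => // j _.
by rewrite -[X in measurable X]setTI; apply: measurable_funPT => //.
Qed.

Let P_atom A : P (atom A) = ((2 ^+ n)^-1)%:E.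
Proof.
rewrite (indY (J := [set: 'I_n]%SET) (B := sgn A))//.
rewrite (eq_bigr (fun=> (1 / 2)%:E)); last first.
  move=> j _; have [h1 h2] := radY j; rewrite /sgn; by case: ifP.
rewrite prodEFin.
by rewrite big_const cardsT card_ord iter_mulr_1 div1r exprVn.
Qed.

Let atom_sum A t : atom A t -> \sum_(j < n) Y j t = 2 * #|A|%:R - n%:R.
Proof.
move=> At.
rewrite (eq_bigr (fun j => 2 * (j \in A)%:R - 1)); last first.
  move=> j _; have := At j (ltac:(by rewrite /= inE)).
  by rewrite /sgn /=; case: ifP => _ /= ->; ring.
rewrite big_split/= -mulr_sumr sumrN; congr (_ * _ - _).
  by rewrite -natr_sum -sum1_card [in RHS]big_mkcond.
by rewrite sumr_const card_ord.
Qed.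

Let atom_inj A B t : atom A t -> atom B t -> A = B.
Proof.
move=> At Bt; apply/setP => j.
have := At j (ltac:(by rewrite /= inE)).
have := Bt j (ltac:(by rewrite /= inE)).
have pm : (1 : R) = -1 -> False.
  by move=> e; have := @ltr01 R; rewrite -oppr_lt0 -e ltNge ler01.
by rewrite /sgn /=; case: ifP => _; case: ifP => _ //= -> // /esym.
Qed.

Let P_atoms : P (\bigcup_(A in [set: {set 'I_n}]) atom A) = 1%E.
Proof.
rewrite measure_fin_bigcup//; last 2 first.
- exact: finite_finset.
- by move=> A B _ _ [t [At Bt]]; apply: atom_inj At Bt.
rewrite (fsbigE (index_enum {set 'I_n}))//=; last first.
- by move=> A _; rewrite mem_index_enum.
- exact: index_enum_uniq.
rewrite (eq_big xpredT (fun=> ((2 ^+ n)^-1)%:E)); last 2 first.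
- by move=> A; rewrite in_setT.
- by move=> A _; rewrite P_atom.
rewrite sumEFin sumr_const; congr EFin.
have -> : #|{set 'I_n}| = (2 ^ n)%N.
  by rewrite -cardsT -powersetT card_powerset cardsT card_ord.
by rewrite -[LHS]mulr_natl natrX divff.
Qed.

Variable Z : {RV P >-> R}.
Hypothesis ZE : forall t, Z t = \sum_(j < n) Y j t.
Variable h : R -> R.
Hypothesis mh : measurable_fun setT h.

(** A simple function agreeing with [h \o Z] on every atom and zero elsewhere, on which the integral
    can be computed. *)
Let g (t : T) : \bar R :=
  (\sum_(A : {set 'I_n}) (h (2 * #|A|%:R - n%:R))%:E * (\1_(atom A) t)%:E)%E.

Let int_g : P.-integrable setT g.
Proof.
apply: (integrable_sum measurableT) => A _.
by apply: (integrableZl measurableT); apply: integrable_indic.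
Qed.

Let mhZ : measurable_fun setT (EFin \o (h \o Z)).
Proof. by apply/measurable_EFinP; apply: measurableT_comp. Qed.

(* The 2^n disjoint atoms have total mass 1, so the walk lives on them. *)
Let hZ_ae : ae_eq P setT (fun t => (h (Z t))%:E) g.
Proof.
have mU : measurable (\bigcup_(A in [set: {set 'I_n}]) atom A).
  by apply: fin_bigcup_measurable => //; exact: finite_finset.
exists (~` (\bigcup_(A in [set: {set 'I_n}]) atom A)); split.
- exact: measurableC.
- by apply: (etrans (probability_setC P mU)); rewrite P_atoms subee.
- move=> t /= ht [A _ At]; apply: ht => _.
  rewrite /g (bigD1 A)//= big1 ?adde0; last first.
    move=> B BA; rewrite indicE memNset ?mule0// => Bt.
    by move/eqP: BA; apply; apply: atom_inj Bt At.
  by rewrite indicE mem_set// mule1 ZE (atom_sum At).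
Qed.

Lemma walk_integrable : P.-integrable setT (fun t => (h (Z t))%:E).
Proof.
have /integrableP[mg intg] := int_g.
apply/integrableP; split => //.
rewrite (_ : \int[P]_x _ = \int[P]_x `|g x|)%E//.
apply: ge0_ae_eq_integral => //.
- exact: measurableT_comp.
- exact: measurableT_comp.
- by apply: filterS hZ_ae => t + _; move=> /(_ I) <-.
Qed.

Lemma walk_integral : (\int[P]_t (h (Z t))%:E =
  ((2 ^+ n)^-1 * \sum_(k < n.+1) 'C(n, k)%:R * h (2 * k%:R - n%:R))%:E)%E.
Proof.
have /integrableP[mg _] := int_g.
rewrite (ae_eq_integral g)//.
rewrite /g integral_sum//; last first.
  by move=> A; apply: (integrableZl measurableT); apply: integrable_indic.
rewrite -(sum_sets_card n (fun k => h (2 * k%:R - n%:R))) mulr_sumr -sumEFin.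
apply: eq_bigr => A _.
rewrite integralZl//; last exact: integrable_indic.
rewrite integral_indic// setIT [in RHS]mulrC EFinM; congr (_ * _)%E.
exact: P_atom.
Qed.

End walk_law.

(** Applied below with [h] the identity (mean), the indicator of a half-line (tail) and a quadratic
    (second moment). *)
Lemma random_walk_law (R : realType) (disp : measure_display)
    (T : measurableType disp)
    (P : probability T R) (n : nat) (Z : {RV P >-> R}) (h : R -> R) :
  symmetric_random_walk n Z -> measurable_fun setT h ->
  P.-integrable setT (fun t => (h (Z t))%:E) /\
  (\int[P]_t (h (Z t))%:E =
  ((2 ^+ n)^-1 * \sum_(k < n.+1) 'C(n, k)%:R * h (2 * k%:R - n%:R))%:E)%E.
Proof.
move=> [Y [indY radY ZE]] mh; split.
  exact: (walk_integrable indY radY ZE mh).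
exact: (walk_integral indY radY ZE mh).
Qed.

Lemma walk_tail_ge (R : realType) (disp : measure_display)
    (T : measurableType disp) (P : probability T R) (n : nat)
    (Z : {RV P >-> R}) (t q : R) (k0 m : nat) :
  symmetric_random_walk n Z ->
  (forall k, (k0 <= k < k0 + m)%N ->
     [/\ (k <= n)%N, t <= 2 * k%:R - n%:R & q <= 'C(n, k)%:R / 2 ^+ n]) ->
  ((m%:R * q)%:E <= P (Z @^-1` `[t, +oo[))%E.
Proof.
move=> hZ hk.
have mI : measurable (`[t, +oo[ : set R) by [].
have mh : measurable_fun setT (\1_(`[t, +oo[) : R -> R).
  exact: measurable_indic.
have [_] := random_walk_law hZ mh.
have -> : (\int[P]_x (\1_`[t, +oo[ (Z x))%:E = P (Z @^-1` `[t, +oo[))%E.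
  have mZ : measurable (Z @^-1` `[t, +oo[).
    by rewrite -[X in measurable X]setTI; apply: measurable_funPT.
  by rewrite -[in RHS](setIT (Z @^-1` _)) -integral_indic//.
move=> ->; rewrite lee_fin mulr_sumr.
pose F k : R := (2 ^+ n)^-1 * ('C(n, k)%:R * \1_`[t, +oo[ (2 * k%:R - n%:R)).
rewrite -(big_mkord xpredT F).
have F0 k : 0 <= F k by rewrite !mulr_ge0// ?invr_ge0 ?exprn_ge0// indicE ler0n.
(* The inclusion of the window in [[0, n]] is read off its last element [k0 + m - 1], which exists
   only for [m > 0]. *)
have [->|m0] := posnP m; first by rewrite mul0r sumr_ge0.
have kn : (k0 + m <= n.+1)%N.
  rewrite -(prednK m0) addnS ltnS.
  by have [] := hk (k0 + m.-1)%N
    (ltac:(by rewrite leq_addr/= ltn_add2l prednK)).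
apply: (@le_trans _ _ (\sum_(k0 <= k < k0 + m) F k)).
  rewrite mulr_natl -[X in _ *+ X](addKn k0) -sumr_const_nat.
  rewrite big_nat_cond [leRHS]big_nat_cond; apply: ler_sum => k.
  rewrite andbT => /hk [_ tk qk]; apply: (le_trans qk).
  by rewrite /F indicE mem_set ?mulr1 ?(mulrC (_^-1))//= in_itv/= tk.
rewrite (big_cat_nat (n := k0) (leq0n _) (leq_trans (leq_addr _ _) kn))/=.
rewrite [X in _ <= _ + X](big_cat_nat (n := k0 + m) (leq_addr _ _) kn)/=.
by rewrite addrCA lerDl addr_ge0// sumr_ge0.
Qed.

(** * The maximum of independent walks *)

Section max_walks.
Variables (R : realType) (disp : measure_display) (T : measurableType disp).
Variables (P : probability T R) (n d : nat) (Z : 'I_d -> {RV P >-> R}).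
Hypothesis hZ : forall i, symmetric_random_walk n (Z i).
Variable i0 : 'I_d.

(** The default [Z i0 t] is itself one of the competing values, so this is the true maximum even
    when all walks are negative. *)
Let M t := \big[Num.max/Z i0 t]_(i < d) Z i t.

Let le_M i t : Z i t <= M t.
Proof. exact: le_bigmax_cond. Qed.

Let measurable_M : measurable_fun setT M.
Proof.
rewrite /M; elim: (index_enum _) => [|i s IHs].
  by under eq_fun do rewrite big_nil; exact: measurable_funPT.
under eq_fun do rewrite big_cons.
exact: measurable_maxr.
Qed.

Let integrable_Z i : P.-integrable setT (EFin \o Z i).
Proof. by have [] := random_walk_law (hZ i) (@measurable_id _ R setT). Qed.

Let integrable_M : P.-integrable setT (EFin \o M).
Proof.
apply: (@le_integrable _ _ _ _ _ measurableT _
  (fun t => \sum_(i < d) `|(Z i t)%:E|)%E).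
- exact/measurable_EFinP.
- move=> t _; rewrite [leRHS]gee0_abs; last by rewrite sume_ge0.
  under eq_bigr do rewrite abse_EFin.
  rewrite sumEFin lee_fin.
  have h i : `|Z i t| <= \sum_(i < d) `|Z i t|.
    by rewrite (bigD1 i)//= lerDl sumr_ge0.
  rewrite ler_norml; apply/andP; split.
    by rewrite (le_trans _ (le_M i0 t))// lerNl (le_trans _ (h i0))//
      -normrN ler_norm.
  by apply: bigmax_le => [|i _]; rewrite (le_trans (ler_norm _)).
- apply: integrable_sum => // i _; apply: integrable_abse.
  exact: integrable_Z.
Qed.

Lemma expectation_max_walks_ge0 : (0 <= 'E_P[M])%E.
Proof.
rewrite unlock.
have [_] := random_walk_law (hZ i0) (@measurable_id _ R setT).
have -> : \sum_(k < n.+1) 'C(n, k)%:R * id (2 * k%:R - n%:R) =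
    \sum_(k < n.+1) 'C(n, k)%:R * (0 + 1 * (2 * k%:R - n%:R)
       + 0 * (2 * k%:R - n%:R) ^+ 2) :> R.
  by apply: eq_bigr => k _; congr (_ * _) => /=; ring.
rewrite sum_bin_moments mul0r addr0 !mulr0 => E0; rewrite -[leLHS]E0.
apply: (le_integral measurableT (integrable_Z i0) integrable_M) => t _.
by rewrite lee_fin.
Qed.

Hypothesis indZ : mutually_independent Z.

Lemma expectation_max_walks_ge (t p : R) : (0 < n)%N -> 0 <= t ->
  (forall i, p%:E <= P (Z i @^-1` `[t, +oo[))%E ->
  (((1 - expR (- (d%:R * p))) * t - Num.sqrt n%:R)%:E <= 'E_P[M])%E.
Proof.
move=> n0 t0 hp.
have s0 : 0 < Num.sqrt n%:R :> R by rewrite sqrtr_gt0 ltr0n.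
have s2 : Num.sqrt n%:R ^+ 2 = n%:R :> R by rewrite sqr_sqrtr.
set s := Num.sqrt n%:R in s0 s2 *.
pose G := \bigcap_(i in [set` [set: 'I_d]%SET]) (Z i @^-1` `]-oo, t[).
have mZ i (B : set R) : measurable B -> measurable (Z i @^-1` B).
  by move=> mB; rewrite -[X in measurable X]setTI; apply: measurable_funPT.
have mG : measurable G.
  by apply: fin_bigcap_measurable => // i _; exact: mZ.
(* Independence factors the probability that all walks stay below [t], and each factor is at most
   [1 - p <= exp (- p)]. *)
have PG : (P G <= (expR (- (d%:R * p)))%:E)%E.
  rewrite /G (indZ (J := [set: 'I_d]%SET) (B := fun=> `]-oo, t[%classic))//.
  have hi i : P (Z i @^-1` `]-oo, t[) = (fine (P (Z i @^-1` `]-oo, t[)))%:E.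
    by rewrite fineK// fin_num_measure//; exact: mZ.
  rewrite (eq_bigr _ (fun i _ => hi i)) prodEFin lee_fin.
  have -> : expR (- (d%:R * p)) = \prod_(i in [set: 'I_d]%SET) expR (- p).
    by rewrite prodr_const cardsT card_ord -expRM_natl mulrN.
  apply: ler_prod => i _; rewrite fine_ge0//=.
  rewrite -lee_fin -hi.
  have -> : Z i @^-1` `]-oo, t[ = ~` (Z i @^-1` `[t, +oo[).
    by rewrite preimage_setC setCitvr.
  rewrite (probability_setC P (mZ _ _ _))//.
  apply: (@le_trans _ _ (1 - p)%:E).
    by rewrite EFinB leeB.
  by rewrite lee_fin (le_trans _ (expR_ge1Dx _)).
(* By AM-GM [h] dominates [|x|]; the scale [s = sqrt n] makes the mean of [h (Z i0)] equal to [s],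
   as the variance is [s^2]. *)
pose h (x : R) : R := (x ^+ 2 / s + s) / 2.
have mh : measurable_fun setT h.
  apply: measurable_funM => //; apply: measurable_funD => //.
  by apply: measurable_funM => //; exact: measurable_funX.
have [inth Eh] := random_walk_law (hZ i0) mh.
have {}Eh : (\int[P]_x (h (Z i0 x))%:E = s%:E)%E.
  rewrite Eh; congr EFin.
  rewrite (eq_bigr (fun k : 'I_n.+1 => 'C(n, k)%:R *
      (s / 2 + 0 * (2 * k%:R - n%:R)
       + (1 / (2 * s)) * (2 * k%:R - n%:R) ^+ 2))); last first.
    by move=> k _; congr (_ * _); rewrite /h; field; rewrite gt_eqF.
  rewrite sum_bin_moments mulrA mulVf ?mul1r; last by rewrite expf_neq0.
  by rewrite -s2; field; rewrite gt_eqF.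
rewrite unlock.
(* A minorant of [M]: off [G] some walk reaches [t], and on [G] one has
   [M >= Z i0 >= - h (Z i0)]. *)
pose g x : \bar R := ((t * \1_(~` G) x)%:E - (h (Z i0 x))%:E)%E.
have int1 : P.-integrable setT (fun x => (t * \1_(~` G) x)%:E).
  under eq_fun do rewrite EFinM.
  by apply: integrableZl => //; apply: integrable_indic; exact: measurableC.
apply: (@le_trans _ _ (\int[P]_x g x)%E); last first.
  apply: (le_integral measurableT _ integrable_M); first exact: integrableB.
  move=> x _; rewrite /g -EFinB lee_fin.
  have hge : `|Z i0 x| <= h (Z i0 x).
    rewrite /h -(real_normK (num_real (Z i0 x))) ler_pdivlMr//.
    move: `|Z i0 x| => a.
    have -> : a ^+ 2 / s + s = (a ^+ 2 + s ^+ 2) / s by field; rewrite gt_eqF.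
    by rewrite ler_pdivlMr//; have := sqr_ge0 (a - s); lra.
  have := normr_ge0 (Z i0 x).
  rewrite indicE; have [xG|xG] := boolP (x \in ~` G).
    move: xG; rewrite inE => xG.
    suff : t <= M x by rewrite /= mulr1; lra.
    rewrite leNgt; apply/negP => Mt; apply: xG => i _ /=.
    by rewrite in_itv/= (le_lt_trans (le_M i x)).
  have : - `|Z i0 x| <= M x.
    by rewrite (le_trans _ (le_M i0 x))// lerNl -normrN ler_norm.
  by rewrite /= mulr0; lra.
rewrite /g integralB// Eh.
under eq_integral do rewrite EFinM.
rewrite integralZl//; last by apply: integrable_indic; exact: measurableC.
rewrite integral_indic ?setIT//; last exact: measurableC.
rewrite EFinB leeB// [in leLHS]mulrC EFinM.
apply: lee_wpmul2l; first by rewrite lee_fin.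
by rewrite [leRHS](probability_setC P mG) EFinB leeB.
Qed.

End max_walks.

(** The condition [2 r <= w] ensures that the window of endpoints holds an integer [k];
    [Q / (2 r w) <= x0] keeps it where [psi <= psi x0 = r^2]. *)
Lemma walk_tail_psi (R : realType) (disp : measure_display)
    (T : measurableType disp) (P : probability T R) (n : nat)
    (Z : {RV P >-> R}) (x0 Q : R) :
  let r := Num.sqrt (psi x0) in let w := Num.sqrt n%:R in
  symmetric_random_walk n Z -> 0 < x0 < 1 / 2 -> 1 <= Q ->
  2 * r <= w -> Q / (2 * r * w) <= x0 ->
  ((expR (- (Q ^+ 2 / 2)) / (8 * r))%:E
    <= P (Z @^-1` `[(w * (Q - 1) / r)%R, +oo[))%E.
Proof.
move=> r w hZ x0b Q1 rw Qx0.
have psi1 := psi_ge1 x0b.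
have r2 : r ^+ 2 = psi x0 by rewrite sqr_sqrtr//; lra.
have r0 : 0 < r by rewrite sqrtr_gt0; lra.
have w0 : 0 < w by lra.
have w2 : w ^+ 2 = n%:R by rewrite sqr_sqrtr.
have n0 : (0 < n)%N by rewrite -(ltr0n R) -w2 exprn_gt0.
have N0 : 0 < n%:R :> R by rewrite ltr0n.
set t := w * (Q - 1) / r.
have t0 : 0 <= t by rewrite divr_ge0 ?mulr_ge0//; lra.
(* In terms of the number [k] of up-steps, the endpoints between [t] and [w Q / r] form the interval
   from [A] to [A + y]. *)
pose A := (n%:R + t) / 2.
have A0 : 0 <= A by rewrite /A; lra.
pose y := w / (2 * r).
have y1 : 1 <= y by rewrite /y ler_pdivlMr; lra.
have /andP[Al Ar] := truncn_itv A0.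
have /andP[yl yr] := truncn_itv (ltac:(lra) : 0 <= y).
set m := Num.truncn y in yl yr.
set k0 := Num.truncn A in Al Ar.
rewrite -natr1 in Ar; rewrite -natr1 in yr.
have m1 : 1 <= m%:R :> R by rewrite ler1n -(ltr_nat R); lra.
pose q := expR (- (Q ^+ 2 / 2)) / (2 * w).
have q0 : 0 < q by rewrite divr_gt0 ?expR_gt0 ?mulr_gt0.
(* Since [y < m + 1 <= 2 m], rounding costs a factor 2: [y q] has denominator [4 r], [m q] is
   compared with [8 r]. *)
apply: (@le_trans _ _ (m%:R * q)%:E).
  rewrite lee_fin (_ : _ / (8 * r) = (y / 2) * q); last first.
    by rewrite /y /q; field; rewrite !gt_eqF.
  by apply: ler_wpM2r; [exact: ltW|lra].
(* Starting at [k0 + 1] gives [k > A >= n / 2], hence [x > 0] strictly, as [psiE] requires. *)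
apply: (@walk_tail_ge _ _ _ _ _ _ _ _ k0.+1 _ hZ) => k /andP[k0k km].
have kA : A < k%:R.
  by apply: (lt_le_trans Ar); rewrite natr1 ler_nat.
have kAy : k%:R <= A + y.
  have : k%:R <= k0%:R + m%:R :> R by rewrite -natrD ler_nat -ltnS -addSn.
  by lra.
pose x : R := k%:R / n%:R - 1 / 2.
have kx : k%:R = (x + 1 / 2) * n%:R.
  by rewrite /x; field; rewrite gt_eqF.
have xpos : 0 < x.
  by rewrite /x subr_gt0 ltr_pdivlMr//; rewrite /A in kA; lra.
have xQ : x <= Q / (2 * r * w).
  rewrite /x lerBlDr ler_pdivrMr// (le_trans kAy)//.
  rewrite /A /t /y -w2 le_eqVlt; apply/orP; left; apply/eqP.
  by field; rewrite !gt_eqF.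
have xx0 : x <= x0 by lra.
have kn : (k < n)%N.
  by rewrite -(ltr_nat R) kx -[ltRHS]mul1r ltr_pM2r//; lra.
have k1 : (0 < k)%N by rewrite (leq_ltn_trans _ k0k).
split; [exact: ltnW | by rewrite /A in kA; lra |].
apply: le_trans (@bin_entropy_ge R n k _); last by rewrite k1.
rewrite /q ler_pM2r ?invr_gt0 ?mulr_gt0// ler_expR lerN2.
have -> : k%:R / n%:R = 1 / 2 + x by rewrite /x; ring.
rewrite KL_bernoulli_half; last by lra.
have -> : phi (2 * x) / 2 = 2 * x ^+ 2 * psi x.
  by rewrite psiE; [field; rewrite gt_eqF|lra].
(* The factor [r] cancels: [2 n x^2 psi x <= 2 n (Q / (2 r w))^2 r^2 = Q^2 / 2]. *)
have px : psi x <= r ^+ 2 by rewrite r2; apply: psi_ndecr; lra.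
have x2 : x ^+ 2 <= (Q / (2 * r * w)) ^+ 2.
  by rewrite ler_sqr ?nnegrE; lra.
have -> : Q ^+ 2 / 2 = n%:R * (2 * (Q / (2 * r * w)) ^+ 2 * r ^+ 2).
  by rewrite -w2; field; rewrite !gt_eqF.
have psix : 0 <= psi x by have := @psi_ge1 R x (ltac:(lra)); lra.
have xge0 := ltW xpos.
rewrite ler_wpM2l// ler_pM ?mulr_ge0 ?sqr_ge0//; last by rewrite ler_wpM2l.
Qed.

Lemma sqrt_2pi_bounds (R : realType) : 2 <= Num.sqrt (2 * pi : R) <= 3.
Proof.
have h1 := @pi_ge2 R; have h2 := @pihalf_lt2 R.
have s0 : 0 <= Num.sqrt (2 * pi : R) by exact: sqrtr_ge0.
have : Num.sqrt (2 * pi : R) ^+ 2 = 2 * pi by rewrite sqr_sqrtr; lra.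
by nra.
Qed.

(** * The bound of the theorem *)

Section rate.
Variables (R : realType) (n d : nat).
Hypothesis (hd : (2 <= d)%N) (hdn : d%:R <= expR (n%:R / 3) :> R).

Let L : R := ln d%:R.
Let S : R := Num.sqrt L.
Let Q : R := Num.sqrt (2 * L - 2 * ln L).
Let w : R := Num.sqrt n%:R.
Let x0 : R := (16 / 10) * S / (2 * w).
Let r : R := Num.sqrt (psi x0).
Let tau : R := S / ((31 / 10) * Num.sqrt (2 * pi)).
Let a : R := 1 - expR (- tau).

Lemma rate_ln_ge : 1 / 2 <= L.
Proof.
have := ln2_ge R; suff : ln (2 : R) <= L by lra.
by rewrite ler_ln ?posrE ?ltr0n// ?ler_nat//; apply: ltnW.
Qed.

Let L0 : 0 < L. Proof. by have := rate_ln_ge; lra. Qed.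

Lemma rate_ln_le : 3 * L <= n%:R.
Proof.
have d0 : 0 < d%:R :> R by rewrite ltr0n; apply: ltnW.
suff : L <= n%:R / 3 by lra.
by rewrite -[leRHS]expRK ler_ln ?posrE ?expR_gt0.
Qed.

Let S0 : 0 < S. Proof. by rewrite sqrtr_gt0. Qed.

Let S2 : S ^+ 2 = L. Proof. by rewrite sqr_sqrtr// ltW. Qed.

Let w2 : w ^+ 2 = n%:R. Proof. by rewrite sqr_sqrtr. Qed.

Let w0 : 0 < w.
Proof. by rewrite sqrtr_gt0; have := rate_ln_le; have := L0; lra. Qed.

(** The upper bound means [1.6 S < w], which follows from [3 L <= n] because [1.6^2 = 2.56 < 3]. *)
Lemma rate_x0_bounds : 0 < x0 < 1 / 2.
Proof.
apply/andP; split; first by rewrite divr_gt0// mulr_gt0.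
rewrite ltr_pdivrMr ?mulr_gt0//.
have := rate_ln_le; rewrite -S2 -w2; have := S0; have := w0; nra.
Qed.

Let psi1 : 1 <= psi x0. Proof. exact: psi_ge1 rate_x0_bounds. Qed.

Let r2 : r ^+ 2 = psi x0. Proof. by rewrite sqr_sqrtr//; have := psi1; lra. Qed.

Let r1 : 1 <= r.
Proof. by rewrite -sqrtr1 ler_sqrt; have := psi1; lra. Qed.

Let r32 : r <= 3 / 2.
Proof. by have := psi_le2 rate_x0_bounds; rewrite -r2; have := r1; nra. Qed.

Let lnL_le : ln L <= L - 1.
Proof.
by have := @le_ln1Dx R (L - 1); rewrite subrKC; apply; have := L0; lra.
Qed.

Let Q2 : Q ^+ 2 = 2 * L - 2 * ln L.
Proof. by rewrite sqr_sqrtr//; have := lnL_le; lra. Qed.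

Lemma rate_gap_ge1 : 1 <= Q.
Proof. by rewrite -sqrtr1 ler_sqrt; have := lnL_le; lra. Qed.

Let Q1 : 1 <= Q := rate_gap_ge1.

Let tau_le : tau <= S / (62 / 10).
Proof.
have /andP[p2 p3] := sqrt_2pi_bounds R.
by rewrite ler_pM2l// lef_pV2 ?posrE; lra.
Qed.

Let tau_ge : S / (93 / 10) <= tau.
Proof.
have /andP[p2 p3] := sqrt_2pi_bounds R.
by rewrite ler_pM2l// lef_pV2 ?posrE; lra.
Qed.

Let a0 : 0 <= a.
Proof.
have : 0 <= tau by have := tau_ge; have := S0; lra.
by rewrite subr_ge0 -expR0 ler_expR oppr_le0.
Qed.

Let a_le : a <= tau.
Proof. by have := expR_ge1Dx (- tau); rewrite /a; lra. Qed.

Lemma rate_lower_bound :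
  (9 / 100) * Num.sqrt (n%:R * L) - 2 * w <= a / r * w * (Q - 1) - w.
Proof.
rewrite sqrtrM// -/w -/S.
suff : (9 / 100) * S - 1 <= a / r * (Q - 1).
  by have := w0; nra.
have c0 : 0 <= a / r by rewrite divr_ge0//; have := r1; lra.
(* The left-hand side [0.09 S - 1] changes sign at [100 / 9]. *)
have [S11|S11] := leP S (100 / 9).
  by apply: (@le_trans _ _ 0); [lra | rewrite mulr_ge0//; have := Q1; lra].
(* Through [ln L = 2 ln S <= 2 (S - 1)], the claim [L <= 2 L - 2 ln L] reduces to
   [(S - 2)^2 >= 0]. *)
have QS : S <= Q.
  rewrite ler_sqrt; last by have := lnL_le; lra.
  have : ln L <= 2 * (S - 1).
    rewrite -S2 lnXn// mulr2n.
    have := @le_ln1Dx R (S - 1); rewrite subrKC => /(_ (ltac:(lra))); lra.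
  have := sqr_ge0 (S - 2); have := S2; lra.
(* Here [tau >= S / 9.3 > 1], so [exp tau >= 1 + tau >= 2]. *)
have a2 : 1 / 2 <= a.
  have : expR (- tau) <= 2^-1.
    rewrite expRN lef_pV2 ?posrE ?expR_gt0//.
    by have := expR_ge1Dx tau; have := tau_ge; lra.
  by rewrite /a; lra.
have c1 : 1 / 4 <= a / r by rewrite ler_pdivlMr; have := r1; have := r32; lra.
by move: (a / r) c1 => c c1; nra.
Qed.

(** Here [Q^2 <= 8 + 2 (1 / L - 1) <= 10], so [Q - 1 <= 3], while [a <= tau <= 2 / 6.2 < 1 / 3]. *)
Lemma rate_le0 : L <= 4 -> a / r * w * (Q - 1) - w <= 0.
Proof.
move=> L4.
have Li : L^-1 <= 2.
  by rewrite invf_ple ?posrE//; have := rate_ln_ge; lra.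
have Q4 : Q <= 4.
  have : - ln L <= L^-1 - 1.
    rewrite -lnV ?posrE//.
    have := @le_ln1Dx R (L^-1 - 1); rewrite subrKC; apply.
    by have : 0 < L^-1; [rewrite invr_gt0; exact: L0 | lra].
  by have := Q2; have := Q1; nra.
have S_le : S <= 2 by have := S2; have := S0; nra.
have ar : a / r <= 1 / 3.
  by rewrite ler_pdivrMr; have := a_le; have := tau_le; have := r1; lra.
have c0 : 0 <= a / r by rewrite divr_ge0//; have := r1; lra.
suff : a / r * (Q - 1) <= 1 by have := w0; nra.
by move: (a / r) ar c0 => c ar c0; have := Q1; nra.
Qed.

Lemma rate_tail : 4 <= L ->
  [/\ 2 * r <= w, Q / (2 * r * w) <= x0 &
      tau <= d%:R * (expR (- (Q ^+ 2 / 2)) / (8 * r))].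
Proof.
move=> L4.
have lnL0 : 0 <= ln L by apply: ln_ge0; lra.
split.
- have := rate_ln_le; rewrite -w2; have := w0.
  by have := psi_le2 rate_x0_bounds; rewrite -r2; have := r1; nra.
(* The constant 1.6 only has to exceed [sqrt 2]: [ln L >= 0] gives [Q^2 <= 2 L]. *)
- have QS : Q <= (16 / 10) * S.
    by have := Q2; have := S2; have := S0; have := Q1; nra.
  have r0 : 0 < r by have := r1; lra.
  apply: ler_pM => //; first by have := Q1; lra.
    by rewrite invr_ge0 !mulr_ge0// ltW.
  rewrite lef_pV2 ?posrE ?mulr_gt0//.
  by have := w0; have := r1; nra.
- have d0 : 0 < d%:R :> R by rewrite ltr0n; apply: ltnW.
  have -> : Q ^+ 2 / 2 = L - ln L by rewrite Q2; lra.
  rewrite opprB expRD expRN !lnK ?posrE//.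
  rewrite (_ : d%:R * _ = L / (8 * r)); last first.
    by field; rewrite !gt_eqF//; have := r1; lra.
  (* It remains to see [8 r tau <= L]: indeed [8 r tau <= 12 S / 6.2 < 2 S <= S^2]. *)
  have S2' : 2 <= S by have := S2; have := S0; nra.
  rewrite ler_pdivlMr; last by have := r1; lra.
  have := tau_le; have := r32; have := r1; rewrite -S2; nra.
Qed.

End rate.

(** * Combination of the two regimes of [L] *)

Unset Implicit Arguments.

Theorem theorem7 (R : realType) (n d : nat)
    (hn : (7 <= n)%N) (hd : (2 <= d)%N) (hdn : d%:R <= expR (n%:R / 3) :> R)
    (disp : measure_display) (T : measurableType disp) (P : probability T R)
    (Z : 'I_d -> {RV P >-> R})
    (hZ : forall i, symmetric_random_walk n (Z i))
    (hind : mutually_independent Z) :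
  let L : R := ln d%:R in
  let bound : R :=
    (1 - expR (- (Num.sqrt L / ((31 / 10) * Num.sqrt (2 * pi)))))
      / Num.sqrt (psi ((16 / 10) * Num.sqrt L / (2 * Num.sqrt n%:R)))
      * Num.sqrt n%:R * (Num.sqrt (2 * L - 2 * ln L) - 1)
    - Num.sqrt n%:R in
  (bound%:E <=
     'E_P[fun t => \big[Num.max/Z (Ordinal (ltnW hd)) t]_(i < d) Z i t])%E
  /\
  (9 / 100) * Num.sqrt (n%:R * L) - 2 * Num.sqrt n%:R <= bound.
Proof.
set i0 := Ordinal (ltnW hd); move=> L bound; split; last first.
  exact: (@rate_lower_bound R n d hd hdn).
have [L4|L4] := leP L 4.
  apply: le_trans (expectation_max_walks_ge0 hZ i0).
  by rewrite lee_fin; exact: (@rate_le0 R n d hd hdn).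
have [rw Qx0 tau_le] := @rate_tail R n d hd hdn (ltW L4).
have n0 : (0 < n)%N by apply: leq_trans hn.
have x0b := rate_x0_bounds hd hdn.
have Q1 := rate_gap_ge1 R hd.
set r := Num.sqrt (psi _) in rw Qx0 tau_le.
set Q := Num.sqrt (_ - _) in Q1 Qx0 tau_le.
set w := Num.sqrt n%:R in rw Qx0.
have r0 : 0 < r by rewrite sqrtr_gt0; have := psi_ge1 x0b; lra.
have t0 : 0 <= w * (Q - 1) / r.
  by rewrite divr_ge0 ?mulr_ge0 ?sqrtr_ge0//; lra.
have tail i := walk_tail_psi (hZ i) x0b Q1 rw Qx0.
apply: le_trans (expectation_max_walks_ge hZ i0 hind n0 t0 tail).
rewrite lee_fin /bound -/r -/Q -/w lerD2r.
rewrite (_ : _ * (Q - 1) =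
    (1 - expR (- (Num.sqrt L / (31 / 10 * Num.sqrt (2 * pi)))))
    * (w * (Q - 1) / r)); last by ring.
apply: ler_wpM2r => //.
by rewrite lerD2l lerN2 ler_expR lerN2.
Qed.
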